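(* Let $A\in\mathbb{R}^{n\times n}$ be symmetric, $A\neq 0$, and let $b\in\mathbb{R}^n$, $b\ne0$. If $b\in\operatorname{range}(A)$, then the final MINRES point $x_\ell$ is the minimum-length solution of $Ax=b$, that is, $Ax_\ell=b$ and $\|x_\ell\|\le\|\hat x\|$ for every $\hat x$ with $A\hat x=b$ (and $r_\ell=b-Ax_\ell=0$).
   Context: All norms are 2-norms and exact arithmetic is assumed. Lanczos process: $v_0=0$, $\beta_1v_1=b$, and for $k=1,2,\dots$: $\alpha_k=v_k^TAv_k$, $\beta_{k+1}v_{k+1}=Av_k-\alpha_kv_k-\beta_kv_{k-1}$, where $\beta_k>0$ is chosen so that $\|v_k\|=1$. The process stops at the first index $k=\ell\le n$ for which $Av_\ell-\alpha_\ell v_\ell-\beta_\ell v_{\ell-1}=0$, and then $\beta_{\ell+1}=0$. Put $V_\ell=[v_1\ \cdots\ v_\ell]$ (orthonormal columns). $T_\ell$ is the symmetric tridiagonal $\ell\times\ell$ matrix with diagonal $\alpha_1,\dots,\alpha_\ell$ and off-diagonal $\beta_2,\dots,\beta_\ell$, so that $AV_\ell=V_\ell T_\ell$. The matrix $T_\ell$ is nonsingular if and only if $b\in\operatorname{range}(A)$. Final MINRES point in the case $b\in\operatorname{range}(A)$: $x_\ell=V_\ell y_\ell$, where $y_\ell$ is the unique minimizer of $\|T_\ell y-\beta_1e_1\|$ over $y\in\mathbb{R}^\ell$ ($e_1$ is the first unit vector). *)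

(* Defs.v *)
From HB Require Import structures.
From mathcomp Require Import all_boot all_order all_algebra.

Set Implicit Arguments.
Unset Strict Implicit.
Unset Printing Implicit Defensive.

Import Order.TTheory GRing.Theory Num.Theory.
Local Open Scope ring_scope.

Definition norm2 (R : rcfType) (m : nat) (x : 'cV[R]_m) : R :=
  Num.sqrt (\sum_i x i 0 ^+ 2).

Definition in_range (R : rcfType) (n : nat) (A : 'M[R]_n) (b : 'cV[R]_n) :
  Prop := exists z : 'cV[R]_n, A *m z = b.

(* The vector A v_k - alpha_k v_k - beta_k v_(k-1); only used for k >= 1. *)
Definition lanczos_residual (R : rcfType) (n : nat) (A : 'M[R]_n)
    (v : nat -> 'cV[R]_n) (alpha beta : nat -> R) (k : nat) : 'cV[R]_n :=
  A *m v k - alpha k *: v k - beta k *: v k.-1.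

(* The sequences keep the indices of the Lanczos recurrence: v_0, ..., v_l,
   alpha_1, ..., alpha_l and beta_1, ..., beta_(l+1); their values at other
   indices are arbitrary and never used. *)
Record lanczos (R : rcfType) (n : nat) (A : 'M[R]_n) (b : 'cV[R]_n)
    (v : nat -> 'cV[R]_n) (alpha beta : nat -> R) (l : nat) : Prop := Lanczos {
  lanczos_index : (1 <= l <= n)%N;
  lanczos_v0 : v 0%N = 0;
  lanczos_v1 : beta 1%N *: v 1%N = b;
  lanczos_alpha : forall k, (1 <= k <= l)%N ->
    alpha k = ((v k)^T *m A *m v k) 0 0;
  lanczos_step : forall k, (1 <= k < l)%N ->
    beta k.+1 *: v k.+1 = lanczos_residual A v alpha beta k;
  lanczos_beta_gt0 : forall k, (1 <= k <= l)%N -> 0 < beta k;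
  lanczos_norm : forall k, (1 <= k <= l)%N -> norm2 (v k) = 1;
  lanczos_stop : lanczos_residual A v alpha beta l = 0;
  lanczos_first : forall k, (1 <= k < l)%N ->
    lanczos_residual A v alpha beta k != 0;
  lanczos_beta_last : beta l.+1 = 0
}.

(* Matrix indices start at 0, so column j of V_l is v_(j+1). *)
Definition lanczos_V (R : rcfType) (n : nat) (v : nat -> 'cV[R]_n) (l : nat) :
  'M[R]_(n, l) := \matrix_(i < n, j < l) v j.+1 i 0.

(* With the same shift, alpha_(i+1) is in position (i, i), and beta_(i+2) in
   positions (i, i+1) and (i+1, i). *)
Definition lanczos_T (R : rcfType) (alpha beta : nat -> R) (l : nat) :
  'M[R]_l :=
  \matrix_(i < l, j < l)
    if i == j :> nat then alpha i.+1
    else if j == i.+1 :> nat then beta j.+1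
    else if i == j.+1 :> nat then beta i.+1
    else 0.

Definition unit_vec1 (R : rcfType) (l : nat) : 'cV[R]_l :=
  \col_(i < l) (i == 0%N :> nat)%:R.

Definition lsq_minimizer (R : rcfType) (m l : nat) (M : 'M[R]_(m, l))
    (c : 'cV[R]_m) (y : 'cV[R]_l) : Prop :=
  forall z : 'cV[R]_l, norm2 (M *m y - c) <= norm2 (M *m z - c).

(* Main.v *)
Require Import Defs.
From HB Require Import structures.
From mathcomp Require Import all_boot all_order all_algebra.
From mathcomp Require Import zify ring.

Set Implicit Arguments.
Unset Strict Implicit.
Unset Printing Implicit Defensive.

Import Order.TTheory GRing.Theory Num.Theory.
Local Open Scope ring_scope.

(** The Lanczos vectors are orthonormal and, as [b] is in the range of the
    symmetric matrix [A], they are all orthogonal to its kernel. Since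
    [A V = V T], a vector [y] with [T y = 0] has [V y] both in the kernel of [A]
    and orthogonal to it, so [V y = 0] and [y = 0]. Hence [T] is invertible, the
    least-squares residual vanishes and [A x = V T y = V (beta_1 e_1) = b].
    Finally [x], being orthogonal to the kernel, is the shortest solution by
    Pythagoras. *)

Definition dot (R : rcfType) (m : nat) (x y : 'cV[R]_m) : R :=
  (x^T *m y) 0 0.

Section Dot.
Variables (R : rcfType) (m : nat).
Implicit Types (x y z : 'cV[R]_m) (a : R).

Lemma dotE x y : dot x y = \sum_i x i 0 * y i 0.
Proof. by rewrite /dot mxE; apply: eq_bigr => i _; rewrite mxE. Qed.

Lemma dotC x y : dot x y = dot y x.
Proof. by rewrite !dotE; apply: eq_bigr => i _; rewrite mulrC. Qed.

Lemma dotDr x y z : dot x (y + z) = dot x y + dot x z.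
Proof. by rewrite /dot mulmxDr mxE. Qed.

Lemma dotZr a x y : dot x (a *: y) = a * dot x y.
Proof. by rewrite /dot -scalemxAr mxE. Qed.

Lemma dotDl x y z : dot (x + y) z = dot x z + dot y z.
Proof. by rewrite dotC dotDr 2!(dotC z). Qed.

Lemma dotZl a x y : dot (a *: x) y = a * dot x y.
Proof. by rewrite dotC dotZr dotC. Qed.

Lemma dotBr x y z : dot x (y - z) = dot x y - dot x z.
Proof. by rewrite -scaleN1r dotDr dotZr mulN1r. Qed.

Lemma dot0r x : dot x 0 = 0.
Proof. by rewrite /dot mulmx0 mxE. Qed.

Lemma dot_ge0 x : 0 <= dot x x.
Proof. by rewrite dotE sumr_ge0 // => i _; rewrite -expr2 sqr_ge0. Qed.

Lemma norm2E x : norm2 x = Num.sqrt (dot x x).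
Proof. by rewrite dotE; congr Num.sqrt; apply: eq_bigr => i _; rewrite expr2. Qed.

Lemma dot_eq0 x : dot x x = 0 -> x = 0.
Proof.
rewrite dotE => /eqP; rewrite psumr_eq0; last first.
  by move=> i _; rewrite -expr2 sqr_ge0.
move/allP => x0; apply/colP => i; rewrite mxE; apply/eqP.
by rewrite -sqrf_eq0 expr2; apply: x0; apply: mem_index_enum.
Qed.

Lemma norm2_0 : norm2 (0 : 'cV[R]_m) = 0.
Proof. by rewrite norm2E dot0r sqrtr0. Qed.

Lemma norm2_le0 x : norm2 x <= 0 -> x = 0.
Proof.
rewrite norm2E => le0; apply: dot_eq0; apply/eqP.
by rewrite eq_le dot_ge0 andbT -sqrtr_eq0 eq_le le0 sqrtr_ge0.
Qed.

(** Pythagoras: with [z = y - x] orthogonal to [x], the squared norm of [y] is that of [x] plus that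
    of [z]. *)
Lemma norm2_orthogonal_le x y : dot x (y - x) = 0 -> norm2 x <= norm2 y.
Proof.
move=> xy; rewrite -(subrKC x y); move: (y - x) xy => z xz.
rewrite !norm2E ler_wsqrtr // dotDr !dotDl xz (dotC z) xz.
by rewrite addr0 add0r lerDl dot_ge0.
Qed.

End Dot.

Lemma dot_mulmx (R : rcfType) (m p : nat) (M : 'M[R]_(m, p)) x y :
  dot x (M *m y) = dot (M^T *m x) y.
Proof. by rewrite /dot trmx_mul trmxK mulmxA. Qed.

(** Extracts single terms from the column sums of [V *m T]. The index [k] is a plain natural number
    because the neighbour [j.+1] of a column [j] may fall outside the matrix. *)
Lemma sum_ord_pick (R : pzRingType) (l k : nat) (F : nat -> R) :
  \sum_(i < l) (if i == k :> nat then F i else 0) = if (k < l)%N then F k else 0.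
Proof.
rewrite -big_mkcond; case: ltnP => [lt_kl|le_lk].
  by rewrite (big_pred1 (Ordinal lt_kl)).
by rewrite big_pred0 // => i; rewrite ltn_eqF // (leq_trans (ltn_ord i)).
Qed.

Section Lanczos.
Variables (R : rcfType) (n : nat) (A : 'M[R]_n) (b : 'cV[R]_n).
Variables (v : nat -> 'cV[R]_n) (alpha beta : nat -> R) (l : nat).
Hypothesis run : lanczos A b v alpha beta l.

Local Notation V := (lanczos_V v l).
Local Notation T := (lanczos_T alpha beta l).

Lemma lanczos_AvE k : (1 <= k < l)%N ->
  A *m v k = beta k.+1 *: v k.+1 + alpha k *: v k + beta k *: v k.-1.
Proof.
by move=> /(lanczos_step run) ->; rewrite /lanczos_residual addrAC !subrK.
Qed.

Lemma lanczos_Av_last : A *m v l = alpha l *: v l + beta l *: v l.-1.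
Proof.
apply/eqP; rewrite -subr_eq0 opprD addrA; apply/eqP.
exact: lanczos_stop run.
Qed.

Lemma lanczos_dot_self k : (1 <= k <= l)%N -> dot (v k) (v k) = 1.
Proof.
move=> /(lanczos_norm run); rewrite norm2E => nrm.
by rewrite -[LHS]sqr_sqrtr ?dot_ge0 // nrm expr1n.
Qed.

(** Column by column this is the three-term recurrence, since a column of [T] has at most three
    nonzero entries. *)
Lemma lanczos_AV : A *m V = V *m T.
Proof.
apply/matrixP => i j.
have -> : (A *m V) i j = (A *m v j.+1) i 0.
  by rewrite !mxE; apply: eq_bigr => k _; rewrite mxE.
(* The sums collect the diagonal, superdiagonal and subdiagonal entries of column [j]. The test
   [j == 0] is needed because [0.-1 = 0] would otherwise pick a spurious superdiagonal term. *)
transitivity (\sum_(k < l) (if k == j :> nat then alpha k.+1 * v k.+1 i 0 else 0)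
  + \sum_(k < l) (if k == j.-1 :> nat then
       if j == 0%N :> nat then 0 else beta j.+1 * v k.+1 i 0 else 0)
  + \sum_(k < l) (if k == j.+1 :> nat then beta k.+1 * v k.+1 i 0 else 0));
  last first.
  rewrite mxE -!big_split /=; apply: eq_bigr => k _; rewrite !mxE.
  case: (eqVneq (k : nat) j) => [->|/eqP kj].
    do ![case: eqP => ?]; rewrite ?addr0 1?mulrC //; lia.
  by do ![case: eqP => ?]; rewrite ?addr0 ?add0r ?mulr0 1?mulrC //; lia.
rewrite (sum_ord_pick l j (fun k => alpha k.+1 * v k.+1 i 0)).
rewrite (sum_ord_pick l j.-1
  (fun k => if j == 0%N :> nat then 0 else beta j.+1 * v k.+1 i 0)).
rewrite (sum_ord_pick l j.+1 (fun k => beta k.+1 * v k.+1 i 0)).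
(* The convention [v 0 = 0] makes this form valid for the first column too. *)
have -> : (if (j.-1 < l)%N then
    if j == 0%N :> nat then 0 else beta j.+1 * v j.-1.+1 i 0 else 0)
    = beta j.+1 * v j i 0.
  rewrite (leq_ltn_trans (leq_pred j)) //; case: eqP => [->|/eqP].
    by rewrite (lanczos_v0 run) mxE mulr0.
  by rewrite -lt0n => /prednK ->.
(* In the last column the subdiagonal term is absent, which matches the stopping condition. *)
rewrite ltn_ord; case: ltnP => jl.
  by rewrite lanczos_AvE ?jl // !mxE; ring.
have jE : j.+1 = l by apply/eqP; rewrite eqn_leq jl ltn_ord.
have predlE : l.-1 = j by lia.
by rewrite addr0 jE lanczos_Av_last predlE !mxE.
Qed.

Lemma lanczos_V_e1 : V *m (beta 1%N *: unit_vec1 R l) = b.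
Proof.
have /andP[l_gt0 _] := lanczos_index run.
rewrite -(lanczos_v1 run) -scalemxAr; congr (_ *: _); apply/colP => i.
rewrite mxE (bigD1 (Ordinal l_gt0)) //= big1 ?addr0 => [|j].
  by rewrite !mxE mulr1.
by rewrite -val_eqE !mxE => /negPf -> ; rewrite mulr0.
Qed.

Hypothesis Asym : A^T = A.

(** Strong induction on the larger index, expanding [beta k.+1 *: v k.+1] by the recurrence. For
    [i = k] the choice of [alpha k] gives the cancellation; for [i < k] symmetry does. Index 0 is
    included so that the predecessors [k.-1] and [i.-1] are always covered. *)
Lemma lanczos_orthogonal i j : (i < j <= l)%N -> dot (v i) (v j) = 0.
Proof.
elim/ltn_ind: j i => -[//|k] IHk i /andP[]; rewrite ltnS => le_ik lt_kl.
have [->|i_gt0] := posnP i; first by rewrite (lanczos_v0 run) dotC dot0r.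
have k_gt0 : (0 < k)%N by apply: leq_trans le_ik.
have kl : (1 <= k < l)%N by rewrite k_gt0.
have /lt0r_neq0/mulfI : 0 < beta k.+1 by apply: (lanczos_beta_gt0 run).
apply; rewrite -dotZr mulr0 (lanczos_step run) // /lanczos_residual !dotBr !dotZr.
have [->|ne_ik] := eqVneq i k.
  have kl' : (1 <= k <= l)%N by lia.
  have vAv : dot (v k) (A *m v k) = alpha k.
    by rewrite (lanczos_alpha run kl') /dot mulmxA.
  have vv' : dot (v k) (v k.-1) = 0 by rewrite dotC; apply: IHk; lia.
  by rewrite vAv vv' (lanczos_dot_self kl') mulr0 mulr1 subrr subr0.
have lt_ik : (i < k)%N by rewrite ltn_neqAle ne_ik.
have vivk : dot (v i) (v k) = 0 by apply: IHk; lia.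
rewrite vivk mulr0 subr0.
(* Moving [A] onto [v i] and expanding again leaves only the [v i.+1] term. *)
rewrite dot_mulmx Asym lanczos_AvE; last by lia.
rewrite !dotDl !dotZl.
rewrite vivk (IHk k _ i.-1); [|lia..].
(* If [i.+1 = k], both remaining terms equal [beta k], by normalization; otherwise both vanish by
   induction. *)
rewrite !mulr0 !addr0; have [<-|ne_iSk] := eqVneq i.+1 k.
  by rewrite /= !lanczos_dot_self ?subrr //; lia.
by rewrite !IHk ?mulr0 ?subrr //; lia.
Qed.

Lemma lanczos_VtV : V^T *m V = 1%:M.
Proof.
apply/matrixP => i j; have -> : (V^T *m V) i j = dot (v i.+1) (v j.+1).
  by rewrite dotE mxE; apply: eq_bigr => k _; rewrite !mxE.
rewrite mxE -val_eqE /=; case: (ltngtP i j) => [lt_ij|lt_ji|->].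
- by rewrite lanczos_orthogonal // ltnS lt_ij ltn_ord.
- by rewrite dotC lanczos_orthogonal // ltnS lt_ji ltn_ord.
- by rewrite lanczos_dot_self //=.
Qed.

Hypothesis b_range : in_range A b.

(** By symmetry [w] is orthogonal to the range of [A], which contains [b] and hence [v 1]; the
    recurrence propagates this to the later vectors. *)
Lemma lanczos_orthogonal_ker w k : A *m w = 0 -> (k <= l)%N -> dot w (v k) = 0.
Proof.
move=> Aw0; have wA z : dot w (A *m z) = 0.
  by rewrite dot_mulmx Asym Aw0 dotC dot0r.
elim/ltn_ind: k => -[|[|k]] IHk le_kl.
- by rewrite (lanczos_v0 run) dot0r.
- have /lt0r_neq0/mulfI : 0 < beta 1%N by apply: (lanczos_beta_gt0 run).
  apply; rewrite -dotZr (lanczos_v1 run) mulr0.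
  by case: b_range => z <-.
have /lt0r_neq0/mulfI : 0 < beta k.+2 by apply: (lanczos_beta_gt0 run).
apply; rewrite -dotZr (lanczos_step run) // /lanczos_residual !dotBr !dotZr wA.
by rewrite !IHk ?mulr0 ?subrr //=; lia.
Qed.

Lemma lanczos_V_orthogonal_ker w y : A *m w = 0 -> dot w (V *m y) = 0.
Proof.
move=> Aw0; rewrite dot_mulmx; suff -> : V^T *m w = 0 by rewrite dotC dot0r.
apply/colP => i; rewrite [RHS]mxE -(lanczos_orthogonal_ker Aw0 (ltn_ord i)).
by rewrite dotE mxE; apply: eq_bigr => k _; rewrite !mxE mulrC.
Qed.

Lemma lanczos_T_inj (y : 'cV[R]_l) : T *m y = 0 -> y = 0.
Proof.
move=> Ty0; have AVy0 : A *m (V *m y) = 0.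
  by rewrite mulmxA lanczos_AV -mulmxA Ty0 mulmx0.
(* The kernel vector [w] is taken to be [V *m y] itself, so it is orthogonal to itself. *)
have /dot_eq0 Vy0 := lanczos_V_orthogonal_ker y AVy0.
by rewrite -[y]mul1mx -lanczos_VtV -mulmxA Vy0 mulmx0.
Qed.

Lemma lanczos_T_unit : T \in unitmx.
Proof.
(* [kermx] concerns row vectors, so transposing turns the claim into injectivity of [T] on
   columns. *)
rewrite -unitmx_tr -row_free_unit -kermx_eq0; apply/rowV0P => u /sub_kermxP uT0.
apply: trmx_inj; rewrite trmx0; apply: lanczos_T_inj.
by rewrite -[T]trmxK -trmx_mul uT0 trmx0.
Qed.

End Lanczos.

(** Comparison with the exact solution [invmx M *m c], whose residual is zero, forces the minimal
    residual to vanish. *)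
Lemma lsq_minimizer_solution (R : rcfType) (l : nat) (M : 'M[R]_l)
    (c y : 'cV[R]_l) : M \in unitmx -> lsq_minimizer M c y -> M *m y = c.
Proof.
move=> Mu /(_ (invmx M *m c)); rewrite mulKVmx // subrr norm2_0.
by move/norm2_le0/eqP; rewrite subr_eq0 => /eqP.
Qed.

Theorem theorem3p1 (R : rcfType) (n : nat) (A : 'M[R]_n) (b : 'cV[R]_n)
    (Asym : A^T = A) (A_neq0 : A != 0) (b_neq0 : b != 0)
    (v : nat -> 'cV[R]_n) (alpha beta : nat -> R) (l : nat)
    (run : lanczos A b v alpha beta l)
    (b_range : in_range A b)
    (y : 'cV[R]_l)
    (y_min : lsq_minimizer (lanczos_T alpha beta l)
               (beta 1%N *: unit_vec1 R l) y)
    (x : 'cV[R]_n) (x_def : x = lanczos_V v l *m y) :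
  [/\ A *m x = b,
      (forall xh : 'cV[R]_n, A *m xh = b -> norm2 x <= norm2 xh)
    & b - A *m x = 0].
Proof.
have Axb : A *m x = b.
  rewrite x_def mulmxA (lanczos_AV run) -mulmxA.
  have Tu := lanczos_T_unit run Asym b_range.
  by rewrite (lsq_minimizer_solution Tu y_min) (lanczos_V_e1 run).
split=> // [xh Axh|]; last by rewrite Axb subrr.
(* The difference [xh - x] of two solutions lies in the kernel of [A], to which [x = V *m y] is
   orthogonal. *)
apply: norm2_orthogonal_le; rewrite dotC x_def.
apply: (lanczos_V_orthogonal_ker run Asym b_range).
by rewrite -x_def mulmxBr Axh Axb subrr.
Qed.
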